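(* Let $\{P_n(x)\}$ be a sequence of standard polynomials and satisfy the recurrence relation $$P_n(x)=a_n(x)P_{n-1}(x)+b_n(x)P'_{n-1}(x)+c_n(x)P_{n-2}(x),$$ where $a_n(x),b_n(x),c_n(x)$ are real polynomials such that $\deg P_n=\deg P_{n-1}$ or $\deg P_n=\deg P_{n-1}+1$. Suppose that for each $n$, the coefficients of $P_n(x)$ are nonnegative (resp. alternating in sign). If $b_n(x)\le 0$ and $c_n(x)\le 0$ whenever $x\le 0$ (resp. $x\ge 0$), then $\{P_n(x)\}$ forms a generalized Sturm sequence. In particular, if for each $n$, $\deg P_n=n$ and either $b_n(x)<0$ or $c_n(x)<0$ whenever $x\le 0$ (resp. $x\ge 0$), then $\{P_n(x)\}$ forms a Sturm sequence.
   Context: A real polynomial is standard if either it is identically zero or its leading coefficient is positive. $\mathrm{RZ}$ denotes the set of real polynomials with only real zeros. For $f,g\in\mathrm{RZ}$, let $\{r_i\}$ and $\{s_j\}$ be all zeros of $f$ and $g$ respectively, in nonincreasing order. We say $g$ alternates left of $f$ (''$g$ alternates $f$'') if $\deg f=\deg g=n$ and $s_n\le r_n\le s_{n-1}\le\cdots\le s_2\le r_2\le s_1\le r_1$. We say $g$ interlaces $f$ if $\deg f=\deg g+1=n$ and $r_n\le s_{n-1}\le\cdots\le s_2\le r_2\le s_1\le r_1$. Write $g\preceq f$ for ''either $g$ alternates $f$ or $g$ interlaces $f$''. By convention, $a\preceq bx+c$ for any real constants $a,b,c$, and $f\preceq 0$, $0\preceq f$ for any real polynomial $f$ with only real zeros.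 A sequence $\{P_n(x)\}_{n\ge 0}$ of standard polynomials is a generalized Sturm sequence if $P_n\in\mathrm{RZ}$ and $P_0\preceq P_1\preceq\cdots\preceq P_{n-1}\preceq P_n\preceq\cdots$. It is a Sturm sequence if $\deg P_n=n$ and $P_{n-1}(r)P_{n+1}(r)<0$ whenever $P_n(r)=0$ and $n\ge 1$.
   Formalization: For the generalized Sturm conclusion, P_0 ⪯ P_1 is assumed as the starting condition (the claim fails without it, e.g. P_n = x²+x+1 for all n with a_n=1, b_n=c_n=0); the recurrence and sign conditions are read for n ≥ 2. *)

(* Defs.v *)
From mathcomp Require Import all_boot all_order all_algebra.
From mathcomp Require Import reals complex.

Set Implicit Arguments.
Unset Strict Implicit.
Unset Printing Implicit Defensive.

Import Order.TTheory GRing.Theory Num.Theory.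
Local Open Scope ring_scope.

Definition standard (R : realType) (p : {poly R}) : Prop :=
  p = 0 \/ 0 < lead_coef p.

(* The zero polynomial is admitted: it is standard, and the conventions
   [preceq f 0] and [preceq 0 f] below treat it as a legitimate term. *)
Definition RZ (R : realType) (p : {poly R}) : Prop :=
  p = 0 \/
  forall z : complex R, root (map_poly (real_complex R) p) z -> complex.Im z = 0.

(* [rs] lists the zeros of [p], with multiplicity, in nonincreasing order. *)
Definition zeros (R : realType) (p : {poly R}) (rs : seq R) : Prop :=
  [/\ p != 0,
      p = lead_coef p *: \prod_(r <- rs) ('X - r%:P) &
      sorted >=%R rs].

(* Lists are indexed from 0, so [rs`_i] is the zero r_{i+1}. *)
Definition alternates (R : realType) (g f : {poly R}) : Prop :=
  [/\ RZ f, RZ g, size f = size g &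
      exists rs ss : seq R,
        [/\ zeros f rs, zeros g ss,
            forall i, (i < size rs)%N -> ss`_i <= rs`_i &
            forall i, (i.+1 < size rs)%N -> rs`_i.+1 <= ss`_i]].

Definition interlaces (R : realType) (g f : {poly R}) : Prop :=
  [/\ RZ f, RZ g, size f = (size g).+1 &
      exists rs ss : seq R,
        [/\ zeros f rs, zeros g ss,
            forall i, (i < size ss)%N -> ss`_i <= rs`_i &
            forall i, (i < size ss)%N -> rs`_i.+1 <= ss`_i]].

Definition preceq (R : realType) (g f : {poly R}) : Prop :=
  [\/ alternates g f,
      interlaces g f,
      exists a b c : R, g = a%:P /\ f = b *: 'X + c%:P |
      [/\ RZ g, RZ f & g = 0 \/ f = 0]].

Definition generalized_sturm (R : realType) (P : nat -> {poly R}) : Prop :=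
  [/\ forall n, standard (P n),
      forall n, RZ (P n) &
      forall n, preceq (P n) (P n.+1)].

(* [size p = n.+1] says that [p] is nonzero of degree [n]. *)
Definition sturm (R : realType) (P : nat -> {poly R}) : Prop :=
  [/\ forall n, standard (P n),
      forall n, size (P n) = n.+1 &
      forall (n : nat) (r : R), (1 <= n)%N -> (P n).[r] = 0 ->
        (P n.-1).[r] * (P n.+1).[r] < 0].

(* deg q = deg p or deg q = deg p + 1, with deg 0 = -oo. Since [size 0 = 0],
   the second case must exclude [p = 0]: otherwise a nonzero constant would
   count as one degree above 0. *)
Definition deg_step (R : realType) (p q : {poly R}) : Prop :=
  size q = size p \/ (p != 0 /\ size q = (size p).+1).

(* Vanishing coefficients are allowed, but the sign pattern is fixed by the
   parity of the index, so that e.g. 'X^3 + 1 is not alternating. *)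
Definition alternating_coefs (R : realType) (p : {poly R}) : Prop :=
  (forall k, 0 <= (-1) ^+ k * p`_k) \/ (forall k, (-1) ^+ k * p`_k <= 0).

(* Main.v *)
(* If [f] has positive leading coefficient, [g] precedes [f] and [b, c <= 0] at
   the zeros of [f], then [f' / f] and [g / f] have simple poles with nonnegative
   residues, so [F / f] has simple poles with nonpositive residues, where
   [F = a f + b f' + c g].  This forces [F] to be real-rooted and [f] to precede
   [F], by induction on the zeros of [f]: if [r] is the largest one, then [F] has
   a zero [u >= r], with [u = r] when [r] is multiple, and dividing [f] by
   [X - r] and [F] by [X - u] preserves the sign of the residues.  Nonnegative
   (alternating) coefficients place the zeros of [P n] in [x <= 0] ([x >= 0]).
   In the strict case, consecutive terms inductively have no common zero; then at
   a zero [r] of [P n] the numbers [P n.-1] and [(P n)'] are nonzero of the same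
   sign, so the recurrence gives [P n.+1] the opposite one. *)
Require Import Defs.
From mathcomp Require Import all_boot all_order all_algebra.
From mathcomp Require Import reals complex polyrcf.
From mathcomp Require Import zify ring lra.

Set Implicit Arguments.
Unset Strict Implicit.
Unset Printing Implicit Defensive.

Import Order.TTheory GRing.Theory Num.Theory.
Local Open Scope ring_scope.

Section Interlacing.

Variable R : realType.
Implicit Types (x r u : R) (s rs ss us : seq R) (f g h F : {poly R}).

(** * Counting zeros above a point *)

Definition above x s := count (fun z => x < z) s.
Definition weakly_above x s := count (fun z => x <= z) s.

Definition monic_of s : {poly R} := \prod_(z <- s) ('X - z%:P).

(* For lists in nonincreasing order this is [rs`_i.+1 <= ss`_i <= rs`_i], but
   stated by counting it is insensitive to order and to common elements. *)
Definition interl ss rs :=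
  forall x, (above x ss <= above x rs <= (above x ss).+1)%N.

Lemma weakly_above_count_mem x s :
  weakly_above x s = (count_mem x s + above x s)%N.
Proof.
rewrite /weakly_above /above; elim: s => //= z s ->.
rewrite le_eqVlt [x == z]eq_sym; case: eqVneq => [->|_]; rewrite ?ltxx ?add0n -?addnA //.
by rewrite addnCA.
Qed.

(** Finiteness leaves some [y < x] with no element of [s] strictly between; it serves all sublists
    at once, so inequalities between strict counts pass to weak counts. *)
Lemma weakly_above_eq_above x s :
  exists y, forall t, {subset t <= s} -> weakly_above x t = above y t.
Proof.
suff [y /allP yx hy]: exists2 y, all (fun z => (x <= z) == (y < z)) s & y < x.
  exists y => t ts; apply: eq_in_count => z /ts /yx /eqP -> //.
elim: s => [|z s [y hy yx]]; first by exists (x - 1) => //; lra.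
case: (leP x z) => xz.
  exists y => //=; rewrite xz (lt_le_trans yx xz) eqxx //.
exists (Num.max y z); last by rewrite gt_max yx.
apply/andP; split.
  by rewrite [x <= z]leNgt xz gt_max ltxx andbF.
apply/allP => w ws; move/allP: hy => /(_ w ws) /eqP xw.
by rewrite gt_max -xw; case: (leP x w) => //= /(lt_le_trans xz) ->.
Qed.

Lemma interl_weakly_above ss rs x : interl ss rs ->
  (weakly_above x ss <= weakly_above x rs <= (weakly_above x ss).+1)%N.
Proof.
have [y hy] := weakly_above_eq_above x (ss ++ rs) => /(_ y).
by rewrite -!hy // => z zs; rewrite mem_cat zs ?orbT.
Qed.

Lemma above_sorted rs x i : sorted >=%R rs ->
  (i < above x rs)%N = (i < size rs)%N && (x < rs`_i).
Proof.
rewrite /above; elim: rs i => [|r rs IH] //= i rs_s.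
have rs_r := order_path_min (rev_trans le_trans) rs_s.
have {}IH := IH _ (path_sorted rs_s).
case: (ltP x r) => xr.
  by case: i => [|i] //=; rewrite add1n ltnS IH.
have -> : count (fun z => x < z) rs = 0%N.
  apply/eqP; rewrite -leqn0 leqNgt -has_count; apply/hasPn => z /(allP rs_r) zr.
  by rewrite -leNgt (le_trans zr xr).
case: i => [|i] /=; first by rewrite ltNge xr.
rewrite ltn0 ltnS; case: ltnP => //= /(mem_nth 0) /(allP rs_r) zr.
by rewrite ltNge (le_trans zr xr).
Qed.

(** * Signs of residues at the zeros *)

Lemma prod_sign x us : x \notin us ->
  0 < (-1) ^+ above x us * (monic_of us).[x].
Proof.
rewrite /monic_of /above; elim: us => [|u us IH]; rewrite ?big_nil ?hornerE //=.
rewrite in_cons negb_or big_cons !hornerE => /andP[xu /IH].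
case: (ltgtP x u) xu => // xu _ H; rewrite /= ?add0n ?add1n ?exprS.
  by rewrite [ltRHS](_ : _ = (u - x) * ((-1) ^+ count (fun z => x < z) us *
    (\prod_(z <- us) ('X - z%:P)).[x])); [rewrite mulr_gt0 ?subr_gt0 | ring].
by rewrite mulrAC mulr_gt0 ?subr_gt0.
Qed.

Lemma monic_of_mem x s :
  monic_of s = ('X - x%:P) ^+ count_mem x s * monic_of (filter (predC1 x) s).
Proof.
rewrite /monic_of; elim: s => [|z s IH]; first by rewrite !big_nil mul1r.
rewrite big_cons IH /=; case: eqVneq => [->|zx] /=.
  by rewrite exprS mulrA.
by rewrite big_cons add0n; ring.
Qed.

Lemma above_filter x s : above x (filter (predC1 x) s) = above x s.
Proof.
rewrite /above; elim: s => //= z s IH.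
by case: eqVneq => [->|_] /=; rewrite ?ltxx IH.
Qed.

(* For [f] with zeros [rs] and positive leading coefficient, this says that
   [h / f] has only simple poles, with nonnegative residues. *)
Definition residue_nneg rs h := forall r, r \in rs ->
  exists2 h1, h = ('X - r%:P) ^+ (count_mem r rs).-1 * h1
            & 0 <= (-1) ^+ above r rs * h1.[r].

(** Interlacing lets the multiplicity of [r] drop by at most one from [rs] to [ss]. If it drops by
    one, both lists have equally many elements above [r] and the signs agree; otherwise the residue
    is 0. *)
Lemma residue_nneg_interl rs ss g :
  g = lead_coef g *: monic_of ss -> 0 < lead_coef g -> interl ss rs ->
  residue_nneg rs g.
Proof.
move=> gE lg sr r rrs; have := sr r; have := interl_weakly_above r sr.
have: (0 < count_mem r rs)%N by rewrite -has_count has_pred1.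
rewrite !weakly_above_count_mem (monic_of_mem r ss) in gE *.
set c := lead_coef g in gE lg *; set q := monic_of _ in gE.
have qs: 0 < (-1) ^+ above r ss * q.[r].
  by rewrite -above_filter prod_sign // mem_filter /= eqxx.
case: (ltngtP (count_mem r rs).-1 (count_mem r ss)) => m; [| lia |] => m0 h1 h2.
  exists (('X - r%:P) ^+ (count_mem r ss - (count_mem r rs).-1) * (c *: q)).
    by rewrite mulrA -exprD subnKC ?(ltnW m) // gE -scalerAr.
  rewrite !hornerE subrr expr0n subn_eq0 leqNgt m /=.
  by rewrite mulr0 !mul0r.
exists (c *: q); first by rewrite gE m -scalerAr.
have -> : above r rs = above r ss by lia.
by rewrite hornerZ mulrCA; apply/ltW/mulr_gt0.
Qed.

(** The logarithmic derivative of [f] has the multiplicity as its residue at each zero; the product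
    rule supplies the cofactor. *)
Lemma residue_nneg_deriv rs f :
  f = lead_coef f *: monic_of rs -> 0 < lead_coef f -> residue_nneg rs f^`().
Proof.
move=> fE lf r rrs.
have: (0 < count_mem r rs)%N by rewrite -has_count has_pred1.
rewrite (monic_of_mem r rs) in fE.
set c := lead_coef f in fE lf *; set q := monic_of _ in fE.
have qs: 0 < (-1) ^+ above r rs * q.[r].
  by rewrite -above_filter prod_sign // mem_filter /= eqxx.
set m := count_mem r rs in fE *; case: m fE => // m fE _ /=.
exists (c *: (q *+ m.+1 + ('X - r%:P) * q^`())).
  rewrite fE derivZ derivM deriv_exp derivXsubC mul1r exprS /= -scalerAr.
  by congr (_ *: _); rewrite mulrnAl mulrDr mulrnAr mulrCA mulrA.
rewrite !hornerZ hornerD hornerMn hornerM hornerXsubC subrr mul0r addr0.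
rewrite mulrCA mulrnAr; apply/ltW/mulr_gt0 => //.
by rewrite pmulrn_lgt0.
Qed.

Lemma residue_nneg_comb rs f g F (a b c : {poly R}) :
  f = lead_coef f *: monic_of rs ->
  residue_nneg rs f^`() -> residue_nneg rs g ->
  (forall r, r \in rs -> b.[r] <= 0 /\ c.[r] <= 0) ->
  F = a * f + b * f^`() + c * g -> residue_nneg rs (- F).
Proof.
move=> fE hf hg bc FE r rrs.
have [hb hc] := bc r rrs.
have [f1 f1E f1s] := hf r rrs; have [g1 g1E g1s] := hg r rrs.
have: (0 < count_mem r rs)%N by rewrite -has_count has_pred1.
rewrite FE f1E g1E fE (monic_of_mem r rs); case: (count_mem r rs) => // m _ /=.
(* [a * f] vanishes at [r] to the full multiplicity, so its cofactor keeps a factor ['X - r%:P] and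
   drops out of the sign test. *)
exists (- (a * (lead_coef f *: (('X - r%:P) * monic_of (filter (predC1 r) rs)))
   + b * f1 + c * g1)).
  by rewrite exprS -!mul_polyC; ring.
rewrite hornerN !hornerD !hornerM hornerZ hornerM hornerXsubC subrr mul0r !mulr0 add0r.
set e := _ ^+ _ in f1s g1s *; rewrite mulrN mulrDr opprD.
by rewrite mulrCA [e * (c.[r] * _)]mulrCA -!mulNr addr_ge0 // mulr_ge0 ?oppr_ge0.
Qed.

(** * Real-rootedness by removing the largest zero *)

Lemma le_root_exists F r : 0 < lead_coef F -> F.[r] <= 0 ->
  exists2 u, r <= u & root F u.
Proof.
move=> lF Fr; have [M hM] := poly_pinfty_gt_lc lF.
have rM : r <= Num.max r M by rewrite le_max lexx.
have FM : 0 <= F.[Num.max r M].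
  by apply: le_trans (hM _ _); [apply: ltW | rewrite le_max lexx orbT].
have [|u /andP[ru _] Fu] := poly_ivt rM (p := F); first by rewrite Fr.
by exists u.
Qed.

Lemma factor_root F u : root F u ->
  exists F1, [/\ F = ('X - u%:P) * F1, lead_coef F = lead_coef F1 &
                 F != 0 -> size F = (size F1).+1].
Proof.
move=> /factor_theorem[F1 ->]; exists F1; split; first exact: mulrC.
  by rewrite lead_coef_Mmonic ?monicXsubC.
by move=> F0; rewrite size_Mmonic ?monicXsubC ?size_XsubC ?addn2 //;
   apply: contraNneq F0 => ->; rewrite mul0r.
Qed.

(** For [r < r1], the cofactor at [r] loses the negative factor [r - u] while one fewer zero lies
    above [r], and the two sign changes cancel. For [r = r1], also [u = r1] and a common factor
    cancels. *)
Lemma residue_nneg_peel r1 rs u F1 : {in rs, forall z, z <= r1} -> r1 <= u ->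
  (r1 \in rs -> u = r1) -> residue_nneg (r1 :: rs) (- (('X - u%:P) * F1)) ->
  residue_nneg rs (- F1).
Proof.
move=> rs_r1 r1u ur1 hF r rrs.
have [|h1] := hF r; first by rewrite in_cons rrs orbT.
have m0: (0 < count_mem r rs)%N by rewrite -has_count has_pred1.
have [r_r1|r_r1] := eqVneq r r1.
  rewrite r_r1 /above /= eqxx ltxx -r_r1 add0n add1n /=.
  rewrite (ur1 _) -?r_r1 // -mulrN -(prednK m0) exprS -mulrA.
  by move=> /(mulfI (negbT (polyXsubC_eq0 r))) hE hs; exists h1.
have lt_r : r < r1 by rewrite lt_neqAle r_r1 rs_r1.
rewrite /above /= eq_sym (negPf r_r1) lt_r add0n add1n => hE.
have ru : r < u by apply: lt_le_trans r1u.
have /factor_root[h2 [h2E _ _]] : root h1 u.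
  have /eqP := congr1 (horner^~ u) hE.
  rewrite hornerN !hornerM horner_exp !hornerXsubC subrr mul0r oppr0 eq_sym.
  by rewrite mulf_eq0 expf_eq0 subr_eq0 [u == r]gt_eqF // andbF.
move: hE; rewrite h2E mulrCA -mulrN => /(mulfI (negbT (polyXsubC_eq0 u))) hE hs.
exists h2 => //; move: hs; rewrite hornerM hornerXsubC exprS mulN1r.
by rewrite mulrCA mulNr mulrN -mulNr opprB pmulr_rge0 ?subr_gt0.
Qed.

(** Only [r1 <= x < u] is delicate: a second zero of [F] above [x] would leave exactly two zeros
    above [r1] and none at it, making [F] positive there. *)
Lemma interl_cons r1 rs u us F : {in rs, forall z, z <= r1} -> r1 <= u ->
  (r1 \in rs -> u = r1) -> 0 < lead_coef F -> F.[r1] <= 0 ->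
  F = lead_coef F *: monic_of (u :: us) -> interl rs us ->
  interl (r1 :: rs) (u :: us).
Proof.
move=> rs_r1 r1u ur1 lF Fr1 FE int x.
have above0 y : r1 <= y -> above y rs = 0%N.
  move=> r1y; apply/eqP; rewrite -leqn0 leqNgt -has_count.
  by apply/hasPn => z /rs_r1 zr; rewrite -leNgt (le_trans zr).
have := int x; rewrite {2 5}/above /above /= -!/(above _ _).
case: (ltP x r1) => [xr|r1x]; first by rewrite (lt_le_trans xr r1u); lia.
rewrite above0 //; case: ltP => [xu|_]; last by lia.
have r1_lt_u := le_lt_trans r1x xu.
have r1rs : r1 \notin rs by apply/negP => /ur1 h; rewrite h ltxx in r1_lt_u.
have := interl_weakly_above r1 int; have := int r1.
rewrite !weakly_above_count_mem (above0 _ (lexx _)) (count_memPn r1rs).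
case us0: (above x us) => [|[|k]]; [lia | | lia].
have : (above x us <= above r1 us)%N.
  by apply: sub_count => z /=; apply: le_lt_trans.
rewrite us0 => ge1 le1 le2.
have above2 : above r1 (u :: us) = 2 by rewrite /above /= -!/(above _ _) r1_lt_u; lia.
have us_r1 : r1 \notin u :: us.
  by rewrite in_cons negb_or lt_eqF //=; apply/count_memPn; lia.
have := prod_sign us_r1; rewrite above2 sqrrN expr1n mul1r => pos.
by move: Fr1; rewrite FE hornerZ leNgt mulr_gt0.
Qed.

Lemma interl_roots rs F : sorted >=%R rs -> 0 < lead_coef F ->
  (size F = (size rs).+1 \/ size F = (size rs).+2) ->
  residue_nneg rs (- F) ->
  exists us, F = lead_coef F *: monic_of us /\ interl rs us.
Proof.
elim: rs F => [|r1 rs IH] F rs_s lF sF hF.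
  have constE (p : {poly R}) : size p = 1%N -> p = lead_coef p *: monic_of [::].
    move=> /eqP/size_poly1P[c _ ->].
    by rewrite lead_coefC /monic_of big_nil alg_polyC.
  case: sF => sF; first by exists [::]; split; [exact: constE|].
  have [u /factor_root[F1 [FE lFE sFE]]] := poly2_root sF.
  exists [:: u]; split; last by move=> x; rewrite /above /=; case: ltP.
  have /constE F1E : size F1 = 1%N.
    have := sFE; rewrite -lead_coef_eq0 gt_eqF // sF => /(_ isT) [].
    by move=> <-.
  by rewrite lFE {1}FE {1}F1E /monic_of !big_cons !big_nil -scalerAr.
have F0 : F != 0 by rewrite -lead_coef_eq0 gt_eqF.
have /allP rs_r := order_path_min (rev_trans le_trans) rs_s.
(* No zero exceeds [r1], so the sign exponent is 0; the power of ['X - r1%:P] takes the value 1 at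
   [r1] if the zero is simple and 0 otherwise. *)
have Fr1 : F.[r1] <= 0.
  have [|h1] := hF r1; first by rewrite mem_head.
  have -> : above r1 (r1 :: rs) = 0%N.
    apply/eqP; rewrite -leqn0 leqNgt -has_count; apply/hasPn => z.
    by rewrite in_cons -leNgt => /orP[/eqP->|/rs_r].
  rewrite mul1r -oppr_ge0 -hornerN => ->; rewrite hornerM horner_exp hornerXsubC.
  by rewrite subrr expr0n; case: eqP; rewrite ?mul1r ?mul0r.
have [u [r1u Fu uE]] : exists u, [/\ r1 <= u, root F u & r1 \in rs -> u = r1].
  have [r1rs|r1rs] := boolP (r1 \in rs).
    exists r1; split => //; have [|h1 hE _] := hF r1; first by rewrite mem_head.
    have m0: (0 < count_mem r1 rs)%N by rewrite -has_count has_pred1.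
    rewrite -rootN hE /= eqxx /= -(prednK m0) exprS -mulrA.
    by rewrite rootM root_XsubC eqxx.
  by have [u r1u Fu] := le_root_exists lF Fr1; exists u.
have [F1 [FE lFE sFE]] := factor_root Fu.
have [||||us [us_E us_rs]] := IH F1.
- exact: path_sorted rs_s.
- by rewrite -lFE.
- by move: sF; rewrite (sFE F0) /=; lia.
- by rewrite FE in hF; apply: residue_nneg_peel hF.
have FE' : F = lead_coef F *: monic_of (u :: us).
  by rewrite lFE {1}FE {1}us_E /monic_of !big_cons -scalerAr.
by exists (u :: us); split => //; apply: interl_cons Fr1 FE' us_rs.
Qed.

(** * Counted interlacing of polynomials and its link with [preceq] *)

Definition zeros_interl g f :=
  exists ss rs, [/\ zeros g ss, zeros f rs & interl ss rs].

Lemma zeros_root f rs r : zeros f rs -> root f r = (r \in rs).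
Proof.
case=> f0 fE _; rewrite fE rootZ ?lead_coef_eq0 //; exact: root_prod_XsubC.
Qed.

Lemma zeros_size f rs : zeros f rs -> size f = (size rs).+1.
Proof.
case=> f0 fE _; rewrite fE size_scale ?lead_coef_eq0 //; exact: size_prod_XsubC.
Qed.

Lemma zeros_RZ f rs : zeros f rs -> RZ f.
Proof.
case=> f0 -> _; right => z; rewrite map_polyZ /= rootZ; last first.
  by rewrite fmorph_eq0 lead_coef_eq0.
rewrite rmorph_prod /= (eq_bigr (fun r => 'X - (real_complex R r)%:P)).
  by rewrite -(big_map _ xpredT (fun z => 'X - z%:P)) root_prod_XsubC => /mapP[r _ ->].
by move=> r _; rewrite map_polyXsubC.
Qed.

Lemma zeros_interl_step g f F (a b c : {poly R}) :
  zeros_interl g f -> 0 < lead_coef g -> 0 < lead_coef f -> 0 < lead_coef F ->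
  (size F = size f \/ size F = (size f).+1) ->
  (forall r, root f r -> b.[r] <= 0 /\ c.[r] <= 0) ->
  F = a * f + b * f^`() + c * g -> zeros_interl f F.
Proof.
move=> [ss [rs [gz fz int]]] lg lf lF sF bc FE.
have [_ gE _] := gz; have [_ fE rs_s] := fz.
have hF : residue_nneg rs (- F).
  apply: residue_nneg_comb FE => //; first exact: residue_nneg_deriv.
    exact: residue_nneg_interl gE lg int.
  by move=> r; rewrite -(zeros_root _ fz); apply: bc.
rewrite (zeros_size fz) in sF.
have [us [FE' int']] := interl_roots rs_s lF sF hF.
(* The zeros come in no guaranteed order; sorting them, as [zeros] demands, leaves the counts
   unchanged. *)
exists rs, (sort >=%R us); split => //.
  split; first by rewrite -lead_coef_eq0 gt_eqF.
    by rewrite {1}FE' /monic_of (perm_big (sort >=%R us)) //= perm_sym perm_sort.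
  by apply: sort_sorted => x y; rewrite /= orbC le_total.
by move=> x; have := int' x; rewrite /above !(permP (permEl (perm_sort _ us))).
Qed.

(** A multiple zero of [f] would be a zero of [g], so [r] is simple; then both values carry the sign
    given by the parity of the number of zeros of [f] above [r]. *)
Lemma zeros_interl_deriv_sign g f r : zeros_interl g f -> 0 < lead_coef g ->
  0 < lead_coef f -> root f r -> g.[r] != 0 -> 0 < f^`().[r] * g.[r].
Proof.
move=> [ss [rs [[_ gE _] fz int]]] lg lf; rewrite (zeros_root _ fz) => rrs gr0.
have [_ fE _] := fz.
have m0: (0 < count_mem r rs)%N by rewrite -has_count has_pred1.
have [g1 g1E g1s] := residue_nneg_interl gE lg int rrs.
have m1 : count_mem r rs = 1%N.
  apply/eqP; rewrite eqn_leq m0 andbT leqNgt; apply: contraNN gr0 => m2.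
  rewrite g1E hornerM horner_exp hornerXsubC subrr expr0n.
  by have /negPf -> : (count_mem r rs).-1 != 0%N; [lia | rewrite mul0r].
rewrite m1 expr0 mul1r in g1E; rewrite -g1E in g1s.
rewrite -/(monic_of rs) (monic_of_mem r) m1 expr1 in fE.
set q := monic_of _ in fE.
have qs: 0 < (-1) ^+ above r rs * q.[r].
  by rewrite -above_filter prod_sign // mem_filter /= eqxx.
have gs: 0 < (-1) ^+ above r rs * g.[r].
  by rewrite lt_neqAle g1s andbT eq_sym mulf_neq0 ?signr_eq0.
have -> : f^`().[r] * g.[r] = lead_coef f *
    (((-1) ^+ above r rs * q.[r]) * ((-1) ^+ above r rs * g.[r])).
  rewrite {1}fE derivZ derivM derivXsubC mul1r hornerZ hornerD hornerM.
  rewrite hornerXsubC subrr mul0r addr0 mulrACA -expr2 sqrr_sign; ring.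
by rewrite mulr_gt0 // mulr_gt0.
Qed.

Lemma interl_nth ss rs : sorted >=%R ss -> sorted >=%R rs ->
  (size ss <= size rs <= (size ss).+1)%N ->
  interl ss rs <->
  (forall i, (i < size ss)%N -> ss`_i <= rs`_i) /\
  (forall i, (i.+1 < size rs)%N -> rs`_i.+1 <= ss`_i).
Proof.
move=> ss_s rs_s /andP[s1 s2]; split => [int|[h1 h2] x].
  (* The counts are tested at the element that ought to be the larger one: a violation puts too many
     elements of the other list above it. *)
  split=> i ilt; rewrite leNgt; apply/negP.
    move=> lt; have := above_sorted rs`_i i ss_s; rewrite ilt lt => is1.
    have /andP[/(leq_trans is1) + _] := int rs`_i.
    by rewrite above_sorted // ltxx andbF.
  move=> lt; have := above_sorted ss`_i i.+1 rs_s; rewrite ilt lt => is1.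
  have /andP[_ /(leq_trans is1)] := int ss`_i.
  by rewrite ltnS above_sorted // ltxx andbF.
(* Conversely, the smaller count serves as an index: an element of its list at that position cannot
   exceed [x], yet the index inequalities say it does. *)
apply/andP; split; rewrite leqNgt; apply/negP.
  move=> lt; have := lt; rewrite above_sorted // => /andP[lts xlt].
  have := above_sorted x (above x rs) rs_s.
  by rewrite ltnn (leq_trans lts s1) (lt_le_trans xlt (h1 _ lts)).
move=> lt; have := lt; rewrite above_sorted // => /andP[lts xlt].
have := above_sorted x (above x ss) ss_s.
have lts2 : (above x ss < size ss)%N by rewrite -ltnS (leq_trans lts).
by rewrite ltnn lts2 (lt_le_trans xlt (h2 _ lts)).
Qed.

Lemma zeros_interl_preceq g f : deg_step g f -> zeros_interl g f -> preceq g f.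
Proof.
move=> dgf [ss [rs [gz fz int]]].
have [g0 _ ss_s] := gz; have [f0 _ rs_s] := fz.
have sg := zeros_size gz; have sf := zeros_size fz.
have szs : (size ss <= size rs <= (size ss).+1)%N.
  by case: dgf => [|[_]]; rewrite sg sf; lia.
have [h1 h2] := (interl_nth ss_s rs_s szs).1 int.
have [gR fR] := (zeros_RZ gz, zeros_RZ fz).
case: dgf => [sgf|[_ sgf]]; [constructor 1 | constructor 2]; split => //.
  by exists rs, ss; split => // i ilt; apply: h1; lia.
by exists rs, ss; split => // i ilt; apply: h2; lia.
Qed.

Lemma zerosC (d : R) : d != 0 -> zeros d%:P [::].
Proof.
by move=> d0; split; rewrite ?polyC_eq0 // lead_coefC big_nil alg_polyC.
Qed.

(** Once neither polynomial is zero, the convention for a constant before [b *: 'X + c%:P] is itself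
    an instance of interlacing: there is at most one zero to count. *)
Lemma preceq_zeros_interl g f : g != 0 -> f != 0 -> preceq g f -> zeros_interl g f.
Proof.
move=> g0 f0 [[_ _ sfg [rs [ss [fz gz h1 h2]]]]|[_ _ sfg [rs [ss [fz gz h1 h2]]]]|
  [a [b [c [gE fE]]]]|[_ _ [/eqP|/eqP]]]; last 2 first.
- by rewrite (negPf g0).
- by rewrite (negPf f0).
- exists ss, rs; split => //; have [_ _ ss_s] := gz; have [_ _ rs_s] := fz.
  rewrite (zeros_size gz) (zeros_size fz) in sfg.
  by apply/interl_nth => //; [lia | split => // i ilt; apply: h1; lia].
- exists ss, rs; split => //; have [_ _ ss_s] := gz; have [_ _ rs_s] := fz.
  rewrite (zeros_size gz) (zeros_size fz) in sfg.
  by apply/interl_nth => //; [lia | split => // i ilt; apply: h2; lia].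
rewrite gE polyC_eq0 in g0; have gz := zerosC g0.
exists [::]; rewrite gE; have [b0|b0] := eqVneq b 0.
  rewrite fE b0 scale0r add0r polyC_eq0 in f0 *.
  by exists [::]; split => //; apply: zerosC.
exists [:: - (c / b)]; split => //; last first.
  by move=> x; rewrite /above /=; case: ltP.
have lE : lead_coef f = b.
  rewrite fE lead_coefDl ?lead_coefZ ?lead_coefX ?mulr1 // size_scale //.
  by rewrite size_polyX size_polyC; case: eqP.
split => //; rewrite lE fE big_seq1 polyCN opprK scalerDr.
by rewrite -[_ *: (c / b)%:P]mul_polyC -polyCM mulrCA mulfV // mulr1.
Qed.

End Interlacing.

(** * Induction along the recurrence *)

Section Recurrence.

Variables (R : realType) (P a b c : nat -> {poly R}).
Hypothesis hstd : forall n, standard (P n).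
Hypothesis hrec : forall n, (2 <= n)%N ->
  P n = a n * P n.-1 + b n * (P n.-1)^`() + c n * P n.-2.
Hypothesis hdeg : forall n, (1 <= n)%N -> deg_step (P n.-1) (P n).
Hypothesis hbc : forall n r, P n != 0 -> root (P n) r ->
  (1 <= n)%N -> (b n.+1).[r] <= 0 /\ (c n.+1).[r] <= 0.

(** [deg_step] preserves both vanishing and non-vanishing; this splits off the identically zero
    sequence. *)
Lemma recurrence_eq0 n : (P n == 0) = (P 0%N == 0).
Proof.
elim: n => // n <-; rewrite -!size_poly_eq0.
case: (@hdeg n.+1 isT) => /= [-> //|[n0 ->]].
by rewrite size_poly_eq0 (negPf n0).
Qed.

Lemma recurrence_lead_gt0 n : P 0%N != 0 -> 0 < lead_coef (P n).
Proof.
by rewrite -(recurrence_eq0 n); case: (hstd n) => // ->; rewrite eqxx.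
Qed.

Lemma recurrence_zeros_interl n :
  P 0%N != 0 -> preceq (P 0%N) (P 1%N) -> zeros_interl (P n) (P n.+1).
Proof.
move=> P0 P01; have Pn k : P k != 0 by rewrite recurrence_eq0.
elim: n => [|n IH]; first exact: preceq_zeros_interl.
have lP k := recurrence_lead_gt0 k P0.
apply: (zeros_interl_step IH _ _ _ _ _ (@hrec n.+2 isT)) => //.
  2: by move=> r rr; apply: hbc.
by case: (@hdeg n.+2 isT) => [|[]]; auto.
Qed.

Lemma recurrence_generalized_sturm :
  preceq (P 0%N) (P 1%N) -> generalized_sturm P.
Proof.
move=> P01; have [P0|P0] := eqVneq (P 0%N) 0.
  have Pn n : P n = 0 by apply/eqP; rewrite recurrence_eq0 P0.
  have RZ0 n : RZ (P n) by left.
  by split => // n; constructor 4; split => //; left.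
have zeros_interl n := recurrence_zeros_interl n P0 P01.
split => // n; last exact: zeros_interl_preceq (@hdeg n.+1 isT) (zeros_interl n).
by have [ss [rs [gz _ _]]] := zeros_interl n; exact: zeros_RZ gz.
Qed.

Hypothesis hsize : forall n, size (P n) = n.+1.
Hypothesis hbc_lt : forall n r, P n != 0 -> root (P n) r ->
  (1 <= n)%N -> (b n.+1).[r] < 0 \/ (c n.+1).[r] < 0.

Lemma recurrence_sturm : sturm P.
Proof.
have P0 : P 0%N != 0 by rewrite -size_poly_eq0 hsize.
have Pn k : P k != 0 by rewrite recurrence_eq0.
have lP k := recurrence_lead_gt0 k P0.
(* Degrees 0 and 1 fall under the convention, which starts the induction. *)
have P01 : preceq (P 0%N) (P 1%N).
  constructor 3; have /eqP/size_poly1P[d _ dE] := hsize 0%N.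
  exists d, (P 1%N)`_1, (P 1%N)`_0; split => //.
  apply/polyP => i; rewrite coefD coefZ coefX coefC.
  case: i => [|[|i]]; rewrite ?mulr0 ?mulr1 ?addr0 ?add0r //=.
  by rewrite nth_default ?hsize.
(* At [r] the first term of the recurrence vanishes. Multiplied by the value of [P n], the other two
   become [b] times a positive product and [c] times a positive square: both nonpositive, one
   negative. *)
have step n r : root (P n.+1) r -> (P n).[r] != 0 ->
    (P n).[r] * (P n.+2).[r] < 0.
  move=> Pr Pnr; have int := recurrence_zeros_interl n P0 P01.
  have := zeros_interl_deriv_sign int (lP _) (lP _) Pr Pnr.
  have [] := hbc (Pn n.+1) Pr isT; have := hbc_lt (Pn n.+1) Pr isT.
  rewrite (hrec (n := n.+2)) //= !hornerE (rootP Pr) mulr0 add0r.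
  have := sqr_ge0 (P n).[r]; have : 0 < (P n).[r] ^+ 2.
    by rewrite lt_neqAle sqr_ge0 eq_sym sqrf_eq0 Pnr.
  move: ((P n).[r]) ((P n.+1)^`().[r]) => u v; nra.
(* At a common zero of consecutive terms the product in [step] would vanish; the induction
   hypothesis for the preceding pair makes [step] applicable. *)
have coprime n r : root (P n.+1) r -> (P n).[r] != 0.
  elim: n r => [|n IH] r Pr.
    have /eqP/size_poly1P[d d0 ->] := hsize 0%N.
    by rewrite hornerC.
  apply/negP => Pr'; have := step _ _ Pr' (IH _ Pr').
  by rewrite (rootP Pr) mulr0 ltxx.
split => // -[//|n] r _ /eqP Pr; exact: step (coprime _ _ Pr).
Qed.

End Recurrence.

(** * Locating zeros by the signs of coefficients *)

Lemma horner_neq0_of_terms (R : realType) (p : {poly R}) (x : R) :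
  p != 0 -> x != 0 -> (forall k, 0 <= p`_k * x ^+ k) -> ~~ root p x.
Proof.
move=> p0 x0 hp; rewrite rootE horner_coef psumr_neq0 //.
have sp : ((size p).-1 < size p)%N by rewrite ltn_predL lt0n size_poly_eq0.
apply/hasP; exists (Ordinal sp); rewrite ?mem_index_enum //=.
by rewrite lt_neqAle hp andbT eq_sym mulf_neq0 ?expf_neq0 // -lead_coefE lead_coef_eq0.
Qed.

Lemma nneg_coefs_root_le0 (R : realType) (p : {poly R}) (r : R) :
  p \is a polyOver Num.nneg -> p != 0 -> root p r -> r <= 0.
Proof.
move=> /polyOverP hp p0; rewrite leNgt; apply: contraL => r0.
apply: horner_neq0_of_terms => // [|k]; first by rewrite gt_eqF.
by apply: mulr_ge0; [rewrite -nnegrE; apply: hp | rewrite exprn_ge0 ?ltW].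
Qed.

Lemma alternating_coefs_root_ge0 (R : realType) (p : {poly R}) (r : R) :
  alternating_coefs p -> p != 0 -> root p r -> 0 <= r.
Proof.
move=> hp p0; rewrite leNgt; apply: contraL => r0.
(* For negative [r] the powers alternate in sign exactly as the coefficients do. *)
have termE k : p`_k * r ^+ k = ((-1) ^+ k * p`_k) * (- r) ^+ k.
  by rewrite [(- r) ^+ k]exprNn mulrACA -expr2 sqrr_sign mul1r.
have rk k : 0 <= (- r) ^+ k by rewrite exprn_ge0 // oppr_ge0 ltW.
have r_neq0 : r != 0 by rewrite lt_eqF.
(* The opposite sign pattern is treated through [- p], which has the same zeros. *)
case: hp => hp; last rewrite -rootN; apply: horner_neq0_of_terms; rewrite ?oppr_eq0 //.
  by move=> k; rewrite termE mulr_ge0.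
by move=> k; rewrite coefN mulNr termE -mulNr mulr_ge0 // oppr_ge0.
Qed.

Theorem corollary2p4 (R : realType) (P a b c : nat -> {poly R})
  (hstd : forall n, standard (P n))
  (hrec : forall n, (2 <= n)%N ->
     P n = a n * P n.-1 + b n * (P n.-1)^`() + c n * P n.-2)
  (hdeg : forall n, (1 <= n)%N -> deg_step (P n.-1) (P n)) :
  ((forall n, P n \is a polyOver Num.nneg) ->
   (forall n (x : R), (2 <= n)%N -> x <= 0 ->
      (b n).[x] <= 0 /\ (c n).[x] <= 0) ->
   (preceq (P 0%N) (P 1%N) -> generalized_sturm P) /\
   ((forall n, size (P n) = n.+1) ->
    (forall n (x : R), (2 <= n)%N -> x <= 0 ->
       (b n).[x] < 0 \/ (c n).[x] < 0) ->
    sturm P))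
  /\
  ((forall n, alternating_coefs (P n)) ->
   (forall n (x : R), (2 <= n)%N -> 0 <= x ->
      (b n).[x] <= 0 /\ (c n).[x] <= 0) ->
   (preceq (P 0%N) (P 1%N) -> generalized_sturm P) /\
   ((forall n, size (P n) = n.+1) ->
    (forall n (x : R), (2 <= n)%N -> 0 <= x ->
       (b n).[x] < 0 \/ (c n).[x] < 0) ->
    sturm P)).
Proof.
split=> hcoef hbc.
  (* The coefficients confine all zeros to the half-line on which [b] and [c] are controlled. *)
  have root_le0 n r : P n != 0 -> root (P n) r -> r <= 0.
    exact: nneg_coefs_root_le0.
  have hbcr n r : P n != 0 -> root (P n) r -> (1 <= n)%N ->
      (b n.+1).[r] <= 0 /\ (c n.+1).[r] <= 0.
    by move=> P0 Pr n1; apply: hbc => //; apply: root_le0 Pr.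
  split=> [|hsize hlt]; first exact: (recurrence_generalized_sturm hstd hrec hdeg hbcr).
  apply: (recurrence_sturm hstd hrec hdeg hbcr hsize) => n r P0 Pr n1.
  by apply: hlt => //; apply: root_le0 Pr.
have root_ge0 n r : P n != 0 -> root (P n) r -> 0 <= r.
  exact: alternating_coefs_root_ge0.
have hbcr n r : P n != 0 -> root (P n) r -> (1 <= n)%N ->
    (b n.+1).[r] <= 0 /\ (c n.+1).[r] <= 0.
  by move=> P0 Pr n1; apply: hbc => //; apply: root_ge0 Pr.
split=> [|hsize hlt]; first exact: (recurrence_generalized_sturm hstd hrec hdeg hbcr).
apply: (recurrence_sturm hstd hrec hdeg hbcr hsize) => n r P0 Pr n1.
by apply: hlt => //; apply: root_ge0 Pr.
Qed.
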